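(* Let $n,k\ge 2$ be integers, let $d:=n-k$, and suppose $n>\max(2^{d},d^{2}+d)$. Let $G\le S_n$. Then $G$ is not Galois closed over $\mathbf{k}$ if and only if there exist a subset $B\subseteq\mathbf{n}$ whose complement $D:=\mathbf{n}\setminus B$ has less than $d$ elements and a permutation group $L\le S_D$ such that $G=A_B\times L$ or $G<_{\mathrm{sd}}S_B\times L$.
   Context: For a positive integer $m$ put $\mathbf{m}=\{1,\dots,m\}$. $S_\Omega$ and $A_\Omega$ denote the symmetric and alternating groups on a finite set $\Omega$; $S_n=S_{\mathbf n}$. ($S_\emptyset$ is the trivial group; $D$ may be empty.) Galois closure: a permutation $\sigma\in S_n$ (written $i\mapsto i\sigma$) leaves an operation $f\colon\mathbf{k}^n\to\mathbf{k}$ invariant if $f(x_1,\dots,x_n)=f(x_{1\sigma},\dots,x_{n\sigma})$ for all $(x_1,\dots,x_n)\in\mathbf{k}^n$. For $G\le S_n$, the Galois closure $\overline{G}^{(k)}$ of $G$ over $\mathbf{k}$ is the subgroup of $S_n$ consisting of all $\sigma\in S_n$ such that every $f\colon\mathbf{k}^n\to\mathbf{k}$ that is invariant under all elements of $G$ is also invariant under $\sigma$. $G$ is Galois closed over $\mathbf{k}$ if $\overline{G}^{(k)}=G$. Products: for disjoint $B,D$ with $\mathbf{n}=B\cup D$ and $G_1\le S_B$, $G_2\le S_D$, the direct product $G_1\times G_2$ is regarded as a subgroup of $S_n$, with the two factors acting independently on the disjoint sets $B$ and $D$. For a subgroup $G\le G_1\times G_2$, write $G\le_{\mathrm{sd}}G_1\times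 G_2$ if $G$ projects onto $G_1$ and onto $G_2$ (subdirect product), and $G<_{\mathrm{sd}}G_1\times G_2$ if moreover $G\ne G_1\times G_2$. *)

(* Defs.v *)
From mathcomp Require Import all_boot all_order all_algebra all_fingroup.

Set Implicit Arguments.
Unset Strict Implicit.
Unset Printing Implicit Defensive.

(* Permutations act on the right, as in MathComp: (s * t) i = t (s i).
   The set {1, ..., m} is represented by 'I_m = {0, ..., m - 1}. *)

Section GaloisClosure.

Variables k n : nat.

Definition permute_args (s : 'S_n) (x : n.-tuple 'I_k) : n.-tuple 'I_k :=
  [tuple tnth x (s i) | i < n].

Definition leaves_invariant (s : 'S_n) (f : {ffun n.-tuple 'I_k -> 'I_k}) : bool :=
  [forall x : n.-tuple 'I_k, f (permute_args s x) == f x].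

Definition galois_closure (G : {set 'S_n}) : {set 'S_n} :=
  [set s : 'S_n | [forall f : {ffun n.-tuple 'I_k -> 'I_k},
     [forall t in G, leaves_invariant t f] ==> leaves_invariant s f]].

Definition galois_closed (G : {set 'S_n}) : Prop := galois_closure G = G.

Lemma permute_argsM s t x :
  permute_args (s * t)%g x = permute_args s (permute_args t x).
Proof. by apply: eq_from_tnth => i; rewrite !tnth_mktuple permM. Qed.

Lemma galois_closure_group_set G : group_set (galois_closure G).
Proof.
apply/group_setP; split=> [|s t].
  rewrite inE; apply/forallP=> f; apply/implyP=> _; apply/forallP=> x.
  suff -> : permute_args 1%g x = x by [].
  by apply: eq_from_tnth => i; rewrite tnth_mktuple perm1.
rewrite !inE => /forallP hs /forallP ht; apply/forallP=> f; apply/implyP=> hG.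
have /forallP fs := implyP (hs f) hG; have /forallP ft := implyP (ht f) hG.
by apply/forallP=> x; rewrite permute_argsM (eqP (fs _)) (eqP (ft x)).
Qed.

Canonical galois_closure_group G := Group (galois_closure_group_set G).

End GaloisClosure.

Section PermOnSubsets.

Variable T : finType.
Implicit Types (B D : {set T}) (G H K : {set {perm T}}).

(* A permutation group on B \subset T is identified with a group of
   permutations of T fixing every point outside B, so that S_B is [Sym B].
   Extending by fixed points preserves parity. *)
Definition Alt_on B : {set {perm T}} := [set s in perm.Sym B | ~~ odd_perm s].

Lemma Alt_on_group_set B : group_set (Alt_on B).
Proof.
apply/group_setP; split=> [|s t]; first by rewrite !inE perm_on1 odd_perm1.
rewrite !inE => /andP[sB es] /andP[tB et].
by rewrite perm_onM // odd_permM (negPf es) (negPf et).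
Qed.

Canonical Alt_on_group B := Group (Alt_on_group_set B).

(* G <=_sd H x K, where H and K consist of permutations supported on the
   disjoint sets B and D; restricting to B and to D gives the projections.
   Such groups commute and meet trivially, so H \x K is their product set. *)
Definition subdirect B D H K G : Prop :=
  [/\ G \subset (H \x K)%g,
      (restr_perm B @* G)%g = H & (restr_perm D @* G)%g = K].

Definition proper_subdirect B D H K G : Prop :=
  subdirect B D H K G /\ G <> (H \x K)%g.

End PermOnSubsets.

(* Main.v *)
Require Import Defs.
From mathcomp Require Import all_boot all_order all_algebra all_fingroup.
From mathcomp Require Import zify.

(* A permutation [s] lies in the closure of [G] iff the coset [G :* s] meets the
   stabilizer of every colouring with at most [k] colours.  Put [d = n - k], and
   let [s] be in the closure but not in [G].  The coset misses 1, but every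
   involution that is a product of at least [d] disjoint transpositions has a
   partial product in the coset; hence there is a largest involution [t] without
   such a partial product, and it moves at most [2(d - 1)] points.  For fixed
   points [i], [j], [l] of [t], maximality gives [w (i j)] and [w' (l j)] in the
   coset, with partial products [w], [w'] of [t]; the fourth power of their
   quotient [w w' (i j)(l j)] is a 3-cycle of [G].  So [G] contains the
   alternating group on the fixed points of [t].  A largest [B] such that [G]
   contains the alternating group on [B] is then invariant under [G].  If its
   complement [D] had at least [d] points, a colouring injective on [B] and on
   [D], together with one constant on [B] and injective on [D], would put 1 in
   the coset.
   Conversely, if [k < #|B|], every [k]-colouring is fixed by a transposition of
   [B], so the closure of a group containing the alternating group on [B] contains
   the symmetric group on [B]; a subdirect product contains the alternating
   group because it meets [Sym B] in a nontrivial normal subgroup. *)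

Set Implicit Arguments.
Unset Strict Implicit.
Unset Printing Implicit Defensive.

(** * Alternating groups on subsets *)

Section Alternating.

Variable T : finType.
Implicit Types (B D : {set T}) (s u : {perm T}) (G N : {group {perm T}}).
Local Open Scope group_scope.

Lemma perm_on_tperm B x y : x \in B -> y \in B -> perm_on B (tperm x y).
Proof.
move=> xB yB; apply: subset_trans (tperm_on _ _) _.
by rewrite subUset !sub1set xB.
Qed.

(** Every transposition [t] on [B] lies in [G u^-1], hence, being its own inverse, also in [u G]; so
    a product of two of them lies in [G]. The induction splits off one transposition at a time. *)
Lemma Alt_on_sub_tperm B G u :
    {in B &, forall x y, x != y -> tperm x y * u \in G} -> Alt_on B \subset G.
Proof.
move=> tuG; apply/subsetP => s /[!inE] /andP[sB es].
suff: if odd_perm s then s * u \in G else s \in G by rewrite (negPf es).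
have [m] := ubnP #|[pred x | s x != x]|; elim: m s sB {es} => // m IHm s sB.
have [x sx ltm | s1 _] := pickP (fun x => s x != x); last first.
  suff ->: s = 1 by rewrite odd_perm1.
  by apply/permP => x; rewrite perm1; apply/eqP; have /negbFE := s1 x.
have xB : x \in B by apply: contraNT sx => /(out_perm sB)->.
have sxB : s x \in B by rewrite perm_closed.
pose t := tperm x (s x); pose s' := s * t.
have -> : s = s' * t by rewrite -mulgA tperm2 mulg1.
have s'B : perm_on B s'.
  by apply: perm_onM; rewrite ?perm_on_tperm.
have tG : t * u \in G by apply: tuG; rewrite // eq_sym.
have /(IHm _ s'B) : #|[pred y | s' y != y]| < m.
  apply: leq_trans (ltnSE ltm); apply/proper_card/properP; split; last first.
    by exists x; rewrite !inE ?permM // tpermR eqxx.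
  apply/subsetP => y; rewrite !inE permM; apply: contraNN => /eqP sy.
  have yx : x != y by apply: contraNneq sx => ->; rewrite sy.
  by rewrite sy tpermD // -sy (inj_eq perm_inj).
have odd_t : odd_perm t by rewrite odd_tperm eq_sym sx.
clearbody s'; rewrite odd_permM odd_t addbT; case: (odd_perm s') => /= s'G.
  by rewrite -[s'](mulgK u) -mulgA groupM // -groupV invMg invgK tpermV.
by rewrite -mulgA groupM.
Qed.

(** Since [(x y) = (a x)(a y)(a x)], the transpositions through [a] suffice: [(x y) u] is the
    product of [(a x) u], [u^-1 (a y)] and [(a x) u]. *)
Lemma Alt_on_sub_tperm_star B G u a : a \in B ->
    {in B, forall x, x != a -> tperm a x * u \in G} -> Alt_on B \subset G.
Proof.
move=> aB auG; apply: (@Alt_on_sub_tperm B G u) => x y xB yB xy.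
have [xa|xa] := eqVneq x a; first by rewrite xa auG -?xa // eq_sym.
have [ya|ya] := eqVneq y a; first by rewrite ya tpermC auG.
have -> : tperm x y = tperm a y ^ tperm a x.
  by rewrite tpermJ tpermL tpermD // eq_sym.
rewrite conjgE tpermV -2!mulgA -[tperm a y](mulKVg u) -mulgA mulgA.
rewrite groupM ?auG // groupM ?auG //.
by rewrite -groupV invMg invgK tpermV auG.
Qed.

Lemma tpermM_Alt_on B a b c d :
  a \in B -> b \in B -> c \in B -> d \in B -> a != b -> c != d ->
  tperm a b * tperm c d \in Alt_on B.
Proof.
move=> aB bB cB dB ab cd; rewrite !inE odd_permM !odd_tperm ab cd andbT.
by apply: perm_onM; rewrite perm_on_tperm.
Qed.

(** For [a], [b] in the intersection, each [(a x)(a b)] is even on [B] or on [D], so the star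
    criterion applies with [u = (a b)]. *)
Lemma Alt_onU B D G : 1 < #|B :&: D| ->
  Alt_on B \subset G -> Alt_on D \subset G -> Alt_on (B :|: D) \subset G.
Proof.
case/card_gt1P=> a [b] [/setIP[aB aD] /setIP[bB bD] ab] AB AD.
apply: (@Alt_on_sub_tperm_star _ _ (tperm a b) a); first by rewrite inE aB.
move=> x /setUP[xB|xD] xa; [apply: (subsetP AB)|apply: (subsetP AD)];
  by rewrite tpermM_Alt_on // eq_sym.
Qed.

Lemma Alt_onJ B G s : s \in G -> Alt_on B \subset G -> Alt_on (s @: B) \subset G.
Proof.
move=> sG /subsetP AB.
have [B1|] := leqP #|B| 1.
  apply/subsetP => u /[!inE] /andP[/perm_on_id-> //].
  by rewrite card_imset //; apply: perm_inj.
case/card_gt1P=> a [b] [aB bB ab].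
apply: (@Alt_on_sub_tperm _ _ (tperm a b ^ s)) => _ _
  /imsetP[x xB ->] /imsetP[y yB ->] xy.
rewrite -tpermJ -conjMg groupJ // AB // tpermM_Alt_on //.
by apply: contraNneq xy => ->.
Qed.

(* A commutator of [v] with a suitable transposition is a 3-cycle, except when
   [v] is an involution without fixed points on [B]; in that case it is a double
   transposition, to which the same argument applies. *)
Lemma Alt_on_sub_normal B N :
  4 < #|B| -> N \subset Sym B -> Sym B \subset 'N(N) -> N :!=: 1 ->
  Alt_on B \subset N.
Proof.
move=> B5 NB nNB ntN.
have tS x y : x \in B -> y \in B -> tperm x y \in Sym B.
  by move=> xB yB; rewrite inE perm_on_tperm.
have NJ u s : u \in N -> s \in Sym B -> u ^ s \in N.
  by move=> uN sB; rewrite memJ_norm // (subsetP nNB).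
have star a b c : a \in B -> b \in B -> c \in B -> b != c -> a != c -> a != b ->
    tperm a b * tperm a c \in N -> Alt_on B \subset N.
  move=> aB bB cB bc ac ab tN.
  apply: (@Alt_on_sub_tperm_star _ _ (tperm a c) a) => // x xB xa.
  have [->|xc] := eqVneq x c; first by rewrite tperm2.
  have := NJ _ (tperm b x) tN (tS _ _ bB xB).
  by rewrite conjMg !tpermJ tpermL !tpermD // eq_sym.
have moved v x : v \in N -> v x != x -> x \in B.
  move=> /(subsetP NB) /[!inE] vB; apply: contraNT => /(out_perm vB)->.
  exact: eqxx.
have imB v x : v \in N -> (v x \in B) = (x \in B).
  by move=> /(subsetP NB) /[!inE] vB; rewrite perm_closed.
have commN v x y : v \in N -> x \in B -> y \in B ->
    tperm x y * tperm (v x) (v y) \in N.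
  move=> vN xB yB; rewrite -tpermJ conjgE !mulgA groupM //.
  by rewrite -{1}tpermV -mulgA -conjgE NJ ?groupV ?tS.
have fixed v x z : v \in N -> v x != x -> z \in B -> v z = z ->
    Alt_on B \subset N.
  move=> vN vx zB vz; have xB := moved _ _ vN vx.
  apply: (star z x (v x)); rewrite ?imB // 1?eq_sym //.
  - by rewrite -vz (inj_eq perm_inj); apply: contraNneq vx => ->; rewrite vz.
  - by apply: contraNneq vx => ->; rewrite vz.
  by rewrite -[in X in _ * X]vz commN.
have [v vN v1] := trivgPn _ ntN.
have [x vx | v_id] := pickP (fun x => v x != x); last first.
  by case/eqP: v1; apply/permP => x; rewrite perm1; apply/eqP/negbFE/v_id.
have xB := moved _ _ vN vx.
have [vvx|vvx] := eqVneq (v (v x)) x; last first.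
  apply: (star (v x) x (v (v x))); rewrite ?imB // 1?eq_sym ?(inj_eq perm_inj) //.
  by rewrite tpermC commN ?imB.
have [z /setDP[zB]] : exists z, z \in B :\: [set x; v x].
  apply/card_gt0P; rewrite cardsD subn_gt0 (leq_ltn_trans _ B5) //.
  apply: leq_trans (subset_leq_card (subsetIr _ _)) _.
  by rewrite cards2; case: (_ != _).
rewrite !inE negb_or => /andP[zx zvx].
have [vz|vz] := eqVneq (v z) z; first exact: (fixed v x z).
have uN := commN _ _ _ vN xB zB.
(* A fifth point of [B] is fixed by the double transposition [(x z)(v x v z)], which reduces to the
   case [fixed]. *)
have [p /setDP[pB]] : exists p, p \in B :\: [set x; v x; z; v z].
  apply/card_gt0P; rewrite cardsD subn_gt0 (leq_ltn_trans _ B5) //.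
  apply: leq_trans (subset_leq_card (subsetIr _ _)) _.
  rewrite -!setUA !cardsU1 cards1.
  by do 3!case: (_ \notin _).
rewrite !inE !negb_or => /andP[/andP[/andP[px pvx] pz] pvz].
apply: (fixed _ x p uN _ pB); last by rewrite permM !tpermD // eq_sym.
by rewrite permM tpermL tpermD // eq_sym.
Qed.

End Alternating.

(** * Restriction to a subset and to its complement *)

Lemma Sym_norm (T : finType) (B : {set T}) : Sym B \subset 'N(B | 'P)%g.
Proof.
apply/subsetP => s /[!inE] sB; apply/subsetP => x xB.
by rewrite inE /= /aperm perm_closed.
Qed.

Section Restriction.

Variables (T : finType) (B : {set T}).
Implicit Types (s : {perm T}) (G H L : {group {perm T}}).
Local Open Scope group_scope.

Lemma restr_perm_id s : perm_on B s -> restr_perm B s = s.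
Proof.
move=> sB; apply/permP => x; have [xB | xB] := boolP (x \in B).
  by rewrite restr_permE //; apply/astabsP => y; apply: perm_closed.
by rewrite (out_perm sB) // (out_perm (restr_perm_on _ _)).
Qed.

Lemma restr_perm_eq1 s : perm_on (~: B) s -> restr_perm B s = 1.
Proof.
move=> sB; have sN : s \in 'N(B | 'P).
  by rewrite -astabsC; apply/astabsP => y; apply: perm_closed.
apply/permP => x; rewrite perm1; have [xB | xB] := boolP (x \in B).
  by rewrite restr_permE // (out_perm sB) // inE xB.
by rewrite (out_perm (restr_perm_on _ _)).
Qed.

Lemma restr_permM_setC s : s \in 'N(B | 'P) ->
  restr_perm B s * restr_perm (~: B) s = s.
Proof.
move=> sN; apply/permP => x; rewrite permM.
have [xB | xB] := boolP (x \in B).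
  rewrite [restr_perm B s x]restr_permE // (out_perm (restr_perm_on _ _)) //.
  rewrite inE negbK.
  by have /astabsP/(_ x) := sN; rewrite /= /aperm => ->.
rewrite (out_perm (restr_perm_on B _)) // restr_permE ?astabsC //.
by rewrite inE xB.
Qed.

Lemma Sym_setC_norm : Sym (~: B) \subset 'N(B | 'P).
Proof. by rewrite -astabsC; apply: Sym_norm. Qed.

Lemma dprod_SymC H L : H \subset Sym B -> L \subset Sym (~: B) -> H \x L = H * L.
Proof.
move=> HB LD; rewrite dprodE //.
  apply/centsP => l lL h hH; apply: (@perm_onC _ (~: B) B).
  - by have := subsetP LD l lL; rewrite inE.
  - by have := subsetP HB h hH; rewrite inE.
  - by rewrite disjoints_subset.
apply/trivgP/subsetP => s /setIP[/(subsetP HB) sB /(subsetP LD) sD].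
move: sB sD; rewrite !inE => sB sD.
by rewrite -(restr_perm_id sB) restr_perm_eq1.
Qed.

End Restriction.

(** * Galois closure and colourings *)

Section Closure.

Variables k n : nat.
Implicit Types (G : {group 'S_n}) (s : 'S_n) (B : {set 'I_n}).
Local Open Scope group_scope.
Hypothesis k_gt1 : 1 < k.

(** The indicator function of the [G]-orbit of [x] is an invariant operation; its two values require
    [1 < k]. *)
Lemma galois_closureP G s :
  reflect (forall x : n.-tuple 'I_k,
             exists2 g, g \in G & permute_args s x = permute_args g x)
          (s \in galois_closure k G).
Proof.
apply: (iffP idP) => [| orb]; last first.
  rewrite inE; apply/forallP => f; apply/implyP => /forallP fG; apply/forallP => x.
  by have [g gG ->] := orb x; have /implyP/(_ gG)/forallP/(_ x) := fG g.
rewrite inE => /forallP sG x.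
pose orb y := [exists g in G, y == permute_args g x].
pose f := [ffun y => if orb y then Ordinal k_gt1 else Ordinal (ltnW k_gt1)].
have /implyP/(_ _)/forallP/(_ x) := sG f; rewrite !ffunE.
have -> : orb x.
  apply/existsP; exists 1; rewrite group1; apply/eqP/eq_from_tnth => i.
  by rewrite tnth_mktuple perm1.
case: ifP => [/existsP[g /andP[gG /eqP e]] _|_ fG]; first by exists g.
suff /fG : [forall t in G, leaves_invariant t f] by [].
apply/forallP => t; apply/implyP => tG; apply/forallP => y; rewrite !ffunE.
suff -> : orb (permute_args t y) = orb y by [].
apply/existsP/existsP => -[g /andP[gG /eqP e]].
  exists (t^-1 * g); rewrite groupM ?groupV //= permute_argsM -e -permute_argsM.
  by rewrite mulVg; apply/eqP/eq_from_tnth => i; rewrite tnth_mktuple perm1.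
by exists (t * g); rewrite groupM //= permute_argsM e.
Qed.

Lemma sub_galois_closure G : G \subset galois_closure k G.
Proof. by apply/subsetP => g gG; apply/galois_closureP => x; exists g. Qed.

(** If [g] in [G] acts on the tuple of colours as [s] does, then [g^-1 * s] preserves the
    colouring. *)
Lemma galois_closure_nat_coloring (f : 'I_n -> nat) G s :
  (forall i, f i < k) -> s \in galois_closure k G ->
  exists2 c, c \in G :* s & forall i, f (c i) = f i.
Proof.
move=> fk /galois_closureP sG.
have [g gG e] := sG [tuple Ordinal (fk i) | i < n].
exists (g^-1 * s) => [|i]; first by rewrite mem_rcoset mulgK groupV.
have := congr1 (fun t => val (tnth t (g^-1 i))) e.
by rewrite !tnth_mktuple /= permM -[g (g^-1 i)]permM mulVg perm1.
Qed.

Lemma galois_closure_coloring (T : finType) (f : 'I_n -> T) G s :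
  #|f @: setT| <= k -> s \in galois_closure k G ->
  exists2 c, c \in G :* s & forall i, f (c i) = f i.
Proof.
move=> fk sG; have fE i : f i \in enum (f @: setT) by rewrite mem_enum imset_f.
pose F i := index (f i) (enum (f @: setT)).
have [i|c cG Fc] := galois_closure_nat_coloring (f := F) _ sG.
  by rewrite (leq_trans _ fk) // cardE index_mem.
by exists c => // i; rewrite -(nth_index (f i) (fE (c i))) -/(F _) Fc nth_index.
Qed.

(** Give [B] one colour and each outside point its own: a permutation preserving this colouring
    fixes every point outside [B]. *)
Lemma galois_closure_Sym B G s : #|~: B| < k -> s \in galois_closure k G ->
  exists2 c, c \in G :* s & c \in Sym B.
Proof.
move=> Dk sG; pose f x := if x \in B then None else Some x.
have [|c cG fc] := galois_closure_coloring (f := f) _ sG.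
  apply: leq_trans Dk; apply: (@leq_trans #|None |: (Some @: ~: B)|).
    apply/subset_leq_card/subsetP => _ /imsetP[x _ ->]; rewrite /f !inE.
    by case: ifP => //= xB; rewrite imset_f // inE xB.
  rewrite cardsU1 card_imset; last by move=> ? ? [].
  by rewrite -add1n leq_add2r leq_b1.
exists c => //; rewrite inE; apply/subsetP => x /[!inE]; apply: contraNT => xB.
by have := fc x; rewrite /f (negPf xB); case: ifP => // _ [->].
Qed.

Lemma Sym_sub_galois_closure B G :
  k < #|B| -> Alt_on B \subset G -> Sym B \subset galois_closure k G.
Proof.
move=> kB /subsetP AG; apply/subsetP => s sB; apply/galois_closureP => x.
have [s_odd|s_even] := boolP (odd_perm s); last first.
  by exists s; rewrite // AG // inE sB.
have /injectivePn : ~~ injectiveb (fun i : {i | i \in B} => tnth x (val i)).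
  apply: contraL kB => /injectiveP /leq_card.
  by rewrite card_sig card_ord -leqNgt.
case=> [[i iB] [[j jB] /= ij xij]].
have {}ij : i != j by [].
exists (s * tperm i j).
  rewrite inE in sB; rewrite AG // 2!inE odd_permM s_odd odd_tperm ij andbT.
  by apply: perm_onM; rewrite ?perm_on_tperm.
apply: eq_from_tnth => l; rewrite !tnth_mktuple permM.
by case: tpermP => [->|->|].
Qed.

End Closure.

(** * Partial products of disjoint transpositions *)

Section PartialInvolutions.

Variables (T : finType).
Implicit Types (s t c w : {perm T}) (G : {group {perm T}}).
Local Open Scope group_scope.

(* For an involution [t]: [c] is the product of some of the disjoint
   transpositions whose product is [t]. *)
Definition subinvolution t c := [forall x, (c x == x) || (c x == t x)].

Lemma subinvolutionP t c :
  reflect (forall x, c x = x \/ c x = t x) (subinvolution t c).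
Proof.
apply: (iffP forallP) => ct x; first by case/orP: (ct x) => /eqP; auto.
by apply/orP; case: (ct x) => /eqP; auto.
Qed.

Lemma subinvolution1 c : subinvolution 1 c -> c = 1.
Proof.
by move/subinvolutionP => c1; apply/permP => x; case: (c1 x) => ->; rewrite perm1.
Qed.

Lemma subinvolution_fix t c x : subinvolution t c -> t x = x -> c x = x.
Proof. by move/subinvolutionP/(_ x) => [->|->]. Qed.

Lemma subinvolution_morph t c x : involutive t -> subinvolution t c ->
  c (t x) = t (c x).
Proof.
move=> tK /subinvolutionP ct.
have [cx|cx] := ct x; have [ctx|ctx] := ct (t x); rewrite cx ctx ?tK //.
  by apply: (@perm_inj _ c); rewrite ctx tK cx.
by apply: (@perm_inj _ c); rewrite cx ctx.
Qed.

Lemma subinvolutionC t w1 w2 : involutive t ->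
  subinvolution t w1 -> subinvolution t w2 -> commute w1 w2.
Proof.
move=> tK w1t w2t; apply/permP => x; rewrite !permM.
have m1 := subinvolution_morph x tK w1t; have m2 := subinvolution_morph x tK w2t.
by have [e1|e1] := subinvolutionP _ _ w1t x;
   have [e2|e2] := subinvolutionP _ _ w2t x; rewrite !(e1, e2, m1, m2).
Qed.

Lemma subinvolution_sqr t w : involutive t -> subinvolution t w -> w * w = 1.
Proof.
move=> tK wt; apply/permP => x; rewrite permM perm1.
have /subinvolutionP/(_ x)[] := wt => wx; rewrite wx //.
by rewrite subinvolution_morph // wx.
Qed.

(** Either [c] fixes both [i] and [j], or it swaps them and multiplication by [(i j)] undoes the
    swap. *)
Lemma subinvolution_tperm t c i j : involutive t -> i != j -> t i = i -> t j = j ->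
  subinvolution (t * tperm i j) c ->
  subinvolution t c \/ subinvolution t (c * tperm i j).
Proof.
move=> tK ij ti tj /subinvolutionP ct.
have ctD x : i != x -> j != x -> c x = x \/ c x = t x.
  move=> ix jx; have := ct x; rewrite permM tpermD //.
    by rewrite -{1}ti (inj_eq perm_inj).
  by rewrite -{1}tj (inj_eq perm_inj).
have [ci|ci] := eqVneq (c i) i.
  left; apply/subinvolutionP => x.
  have [<-|ix] := eqVneq i x; first by left.
  have [<-|jx] := eqVneq j x; last exact: ctD.
  left; have := ct j; rewrite permM tj tpermR => -[//|cj].
  by case/eqP: ij; apply: (@perm_inj _ c); rewrite ci cj.
have {}ci : c i = j.
  by have := ct i; rewrite permM ti tpermL => -[/eqP|//]; rewrite (negPf ci).
have cj : c j = i.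
  have := ct j; rewrite permM tj tpermR => -[cj|//].
  by case/eqP: ij; apply: (@perm_inj _ c); rewrite ci cj.
right; apply/subinvolutionP => x; rewrite permM.
have [<-|ix] := eqVneq i x; first by left; rewrite ci tpermR.
have [<-|jx] := eqVneq j x; first by left; rewrite cj tpermL.
rewrite tpermD; first exact: ctD.
  by rewrite -cj (inj_eq perm_inj).
by rewrite -ci (inj_eq perm_inj).
Qed.

(** The product is a 3-cycle; its cube is computed from the braid relation [aba = bab]. *)
Lemma tperm_braid (i j l : T) : i != j -> l != j -> i != l ->
  (tperm i j * tperm l j) ^+ 3 = 1.
Proof.
move=> ij lj il; have e : tperm i j ^ tperm l j = tperm l j ^ tperm i j.
  by rewrite !tpermJ !tpermR !tpermD // 1?eq_sym // tpermC.
rewrite !expgS expg0 mulg1.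
move: e; rewrite !conjgE !tpermV => e.
by rewrite -!mulgA (mulgA (tperm l j)) e -!mulgA !tpermKg tperm2.
Qed.

(** The quotient of the two coset elements is [w1 * w2 * r] with [r] the 3-cycle. As [w1] and [w2]
    fix [i], [j], [l], the factor [w1 * w2] commutes with [r]; its square is 1, so the fourth power
    is [r^4 = r]. *)
Lemma subinvolution_tpermM_mem G s t w1 w2 i j l :
  involutive t -> t i = i -> t j = j -> t l = l ->
  i != j -> l != j -> i != l ->
  subinvolution t w1 -> subinvolution t w2 ->
  w1 * tperm i j \in G :* s -> w2 * tperm l j \in G :* s ->
  tperm i j * tperm l j \in G.
Proof.
move=> tK ti tj tl ij lj il w1t w2t /rcosetP[g1 g1G e1] /rcosetP[g2 g2G e2].
have tpermCw w x y : subinvolution t w -> t x = x -> t y = y ->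
    commute (tperm x y) w.
  move=> wt tx ty; apply/commgP/conjg_fixP.
  by rewrite tpermJ !(subinvolution_fix wt).
pose r := tperm i j * tperm l j.
have : (w1 * w2) * r \in G.
  suff <- : g1 * g2^-1 = w1 * w2 * r by rewrite groupM ?groupV.
  have -> : g1 * g2^-1 = (w1 * tperm i j) * (w2 * tperm l j)^-1.
    by rewrite e1 e2 invMg mulgA mulgK.
  have w2V : w2^-1 = w2.
    by apply/eqP; rewrite eq_invg_mul (subinvolution_sqr tK w2t).
  rewrite invMg tpermV w2V /r !mulgA -(mulgA w1) -(mulgA w1).
  have c1 := tpermCw _ _ _ w2t ti tj; have c2 := tpermCw _ _ _ w2t tl tj.
  by rewrite -!mulgA c2 (mulgA (tperm i j)) c1 -mulgA.
have cw r' : commute r' w1 -> commute r' w2 -> commute (w1 * w2) r'.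
  by move=> c1 c2; apply/commute_sym/commuteM.
have cr : commute (w1 * w2) r.
  by apply: cw; apply/commute_sym/commuteM; apply/commute_sym/tpermCw.
have w4 : (w1 * w2) ^+ 4 = 1.
  suff w2_1 : (w1 * w2) ^+ 2 = 1 by rewrite (expgM _ 2 2) w2_1 expg1n.
  rewrite expgMn; last exact: subinvolutionC w1t w2t.
  rewrite !expgS !expg0 !mulg1.
  by rewrite (subinvolution_sqr tK w1t) (subinvolution_sqr tK w2t) mulg1.
move/(groupX 4); rewrite expgMn // w4 mul1g (expgSr _ 3) /r tperm_braid //.
by rewrite mul1g.
Qed.

End PartialInvolutions.

(** * Groups that are not Galois closed *)

Section NotClosed.

Variables (k n : nat) (G : {group 'S_n}) (s : 'S_n).
Local Open Scope group_scope.
Hypotheses (k_gt1 : 1 < k) (sG : s \in galois_closure k G) (sNG : s \notin G).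

Lemma one_notin_rcoset : 1 \notin G :* s.
Proof. by rewrite mem_rcoset mul1g groupV. Qed.

(** Colour [x] by its orbit [{x, t x}]. The set of [x] with [t x < x] has one point per
    transposition of [t], so there are at most [k] colours. *)
Lemma involution_meets_rcoset (t : 'S_n) :
  involutive t -> n <= k + #|[set x | t x < x]| ->
  exists2 c, c \in G :* s & subinvolution t c.
Proof.
move=> tK nk; pose f x := [set x; t x].
have [|c cG fc] := galois_closure_coloring k_gt1 (f := f) _ sG.
  rewrite -(leq_add2r #|[set x | t x < x]|); apply: leq_trans nk.
  rewrite -[X in _ <= X]card_ord -(cardsC [set x | t x < x]) addnC leq_add2l.
  apply: leq_trans (leq_imset_card f _); apply/subset_leq_card.
  apply/subsetP => _ /imsetP[x _ ->]; apply/imsetP.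
  have [xt|tx] := leqP x (t x); first by exists x; rewrite // !inE -leqNgt.
  by exists (t x); rewrite /f ?tK 1?setUC // !inE tK -leqNgt ltnW.
exists c => //; apply/subinvolutionP => x; apply/set2P.
by rewrite -[[set _; _]]/(f x) -fc set21.
Qed.

Lemma card_moved_involution (t : 'S_n) : involutive t ->
  #|[set x | t x != x]| <= 2 * #|[set x | t x < x]|.
Proof.
move=> tK; pose A := [set x | t x < x].
rewrite mul2n -addnn -{2}(card_imset (mem A) (@perm_inj _ t)).
apply: leq_trans (subset_leq_card _) (leq_card_setU _ _).
apply/subsetP => x; rewrite !inE neq_ltn => /orP[->//|xt].
by apply/orP; right; apply/imsetP; exists (t x); rewrite ?inE ?tK.
Qed.

Lemma ex_maximal_involution : exists t : 'S_n,
  [/\ involutive t,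
      #|[set x | t x < x]| < n - k &
      forall i j, i != j -> t i = i -> t j = j ->
        exists2 w, subinvolution t w & w * tperm i j \in G :* s].
Proof.
pose P (t : 'S_n) :=
  (t * t == 1) && [forall (c | c \in G :* s), ~~ subinvolution t c].
have P1 : P 1.
  rewrite /P mulg1 eqxx; apply/forall_inP => c cG.
  by apply: contraL cG => /subinvolution1->; apply: one_notin_rcoset.
have [t /andP[/eqP tt /forall_inP tN] tmax] :=
  @arg_maxnP _ 1 P (fun t => #|[set x | t x != x]|) P1.
have tK : involutive t by move=> x; rewrite -permM tt perm1.
exists t; split=> // [|i j ij ti tj].
  rewrite ltnNge; apply/negP => kt.
  have [|c cG ct] := involution_meets_rcoset tK; first by lia.
  by have := tN c cG; rewrite ct.
have tCtp : commute (tperm i j) t.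
  by apply/commgP/conjg_fixP; rewrite tpermJ ti tj.
have ttp : t * tperm i j * (t * tperm i j) = 1.
  by rewrite -mulgA (mulgA _ t) tCtp -mulgA tperm2 mulg1.
(* [t (i j)] moves more points than [t], so by maximality it has a partial product [c] in the coset.
   Since [t] has none, [c] swaps [i] and [j], and [w = c (i j)]. *)
have /forall_inPn[c cG] :
    ~~ [forall (c | c \in G :* s), ~~ subinvolution (t * tperm i j) c].
  apply/negP => /forall_inP PN.
  have /tmax : P (t * tperm i j) by rewrite /P ttp eqxx; apply/forall_inP.
  apply/negP; rewrite -ltnNge; apply/proper_card/properP; split.
    apply/subsetP => x; rewrite !inE permM => tx.
    rewrite tpermD //.
      by rewrite -{1}ti (inj_eq perm_inj); apply: contraNneq tx => <-; rewrite ti.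
    by rewrite -{1}tj (inj_eq perm_inj); apply: contraNneq tx => <-; rewrite tj.
  by exists i; rewrite !inE ?ti ?permM ?ti ?tpermL ?negbK ?eqxx // eq_sym.
rewrite negbK => ct; have [c1|cw] := subinvolution_tperm tK ij ti tj ct.
  by have := tN c cG; rewrite c1.
by exists (c * tperm i j); rewrite // -mulgA tperm2 mulg1.
Qed.

Lemma Alt_on_fixed_sub (t : 'S_n) : involutive t ->
  (forall i j, i != j -> t i = i -> t j = j ->
     exists2 w, subinvolution t w & w * tperm i j \in G :* s) ->
  Alt_on [set x | t x == x] \subset G.
Proof.
move=> tK tG; set U := [set x | _].
have [U1|/card_gt1P[a [b] [aU bU ab]]] := leqP #|U| 1.
  by apply/subsetP => u /[!inE] /andP[/perm_on_id-> //].
apply: (@Alt_on_sub_tperm_star _ _ _ (tperm a b) a) => // x xU xa.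
have [->|xb] := eqVneq x b; first by rewrite tperm2.
move: aU bU xU; rewrite !inE => /eqP ta /eqP tb /eqP tx.
have [w1 w1t w1G] := tG x a xa tx ta.
have [w2 w2t w2G] : exists2 w, subinvolution t w & w * tperm b a \in G :* s.
  by apply: tG; rewrite // eq_sym.
rewrite (tpermC a x) (tpermC a b).
by apply: (subinvolution_tpermM_mem tK tx ta tb) w1t w2t w1G w2G; rewrite // eq_sym.
Qed.

(** With [d = n - k] positive this says [n - 4(d - 1) >= 2]: two sets missing at most [2(d - 1)]
    points each share two points. *)
Hypothesis n_large : 4 * (n - k) <= n + 2.

(** Otherwise all points could get different colours, forcing 1 into the coset. *)
Lemma k_lt_n : k < n.
Proof.
rewrite ltnNge; apply/negP => nk.
have [i|c cG fc] := galois_closure_nat_coloring k_gt1 (f := @nat_of_ord n) _ sG.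
  exact: leq_trans nk.
suff c1 : c = 1 by have := one_notin_rcoset; rewrite -c1 cG.
by apply/permP => i; rewrite perm1; apply/val_inj/fc.
Qed.

Lemma ex_large_Alt_on : exists B : {set 'I_n},
  [/\ #|~: B| <= 2 * (n - k).-1, Alt_on B \subset G & G \subset 'N(B | 'P)].
Proof.
have [t [tK ltA tG]] := ex_maximal_involution.
have AU := Alt_on_fixed_sub tK tG; set U := [set x | _] in AU.
have leU : #|~: U| <= 2 * (n - k).-1.
  have -> : ~: U = [set x | t x != x] by apply/setP => x; rewrite !inE.
  apply: leq_trans (card_moved_involution tK) _; lia.
have [B AB Bmax] := @arg_maxnP _ U (fun B => Alt_on B \subset G) (fun B => #|B|) AU.
have cardB := cardsC B; have cardU := cardsC U; rewrite !card_ord in cardB cardU.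
have leUB : #|U| <= #|B| by apply: Bmax.
have kn := k_lt_n.
exists B; split=> //; first by lia.
apply/subsetP => g gG; rewrite !inE; apply/subsetP => x xB; rewrite inE /= /aperm.
have cgB : #|g @: B| = #|B| by rewrite card_imset //; apply: perm_inj.
have cardI := cardsUI B (g @: B).
have leI : #|B :|: g @: B| <= n by rewrite -[leqRHS]card_ord max_card.
(* The overlap puts the alternating group on the union of [B] and its image into [G]; maximality of
   [B] makes the image equal to [B]. *)
have I_gt1 : 1 < #|B :&: g @: B|.
  by rewrite cgB in cardI; lia.
have /Bmax leB := Alt_onU I_gt1 AB (Alt_onJ gG AB).
have /eqP-> : B == B :|: g @: B by rewrite eqEcard subsetUl.
by rewrite inE imset_f ?orbT.
Qed.

Lemma ex_larger_Alt_on : exists B : {set 'I_n},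
  [/\ #|~: B| < n - k, Alt_on B \subset G & G \subset 'N(B | 'P)].
Proof.
have [B [leD AB GB]] := ex_large_Alt_on; have kn := k_lt_n.
exists B; split=> //; rewrite ltnNge; apply/negP => geD.
have cardB := cardsC B; rewrite card_ord in cardB.
(* One coset element preserving [B] suffices: [G] preserves [B], hence so does the whole coset. *)
have [|c1 c1G c1S] := galois_closure_Sym k_gt1 (B := B) _ sG; first by lia.
have c1B := subsetP (Sym_norm B) c1 c1S.
(* The colour of [x] is its position in its own block. Both blocks have at most [k] points: [B]
   because its complement has at least [d], the complement because [2(d - 1) <= k]. *)
pose C (x : 'I_n) := if x \in B then B else ~: B.
have xC x : x \in enum (C x) by rewrite mem_enum /C; case: ifPn; rewrite // inE.
pose f x := index x (enum (C x)).
have [x|c2 c2G fc2] := galois_closure_nat_coloring k_gt1 (f := f) _ sG.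
  have : f x < #|C x| by rewrite cardE index_mem.
  rewrite /C; case: ifP; lia.
have c2B : c2 \in 'N(B | 'P).
  rewrite -(mulgKV c1 c2) groupM //; apply: (subsetP GB).
  by rewrite -mem_rcoset (rcoset_eqP c1G).
have C_c2 x : C (c2 x) = C x.
  by have /astabsP/(_ x) := c2B; rewrite /C /= /aperm => ->.
suff c2_1 : c2 = 1 by have := one_notin_rcoset; rewrite -c2_1 c2G.
apply/permP => x; rewrite perm1.
have := congr1 (nth x (enum (C x))) (fc2 x).
by rewrite /f C_c2 !nth_index // -C_c2.
Qed.

End NotClosed.

(** * Subdirect products *)

Section Subdirect.

Variables (T : finType) (B : {set T}) (G : {group {perm T}}).
Local Open Scope group_scope.
Hypothesis GB : G \subset 'N(B | 'P).

Lemma mem_morphim_restr g : g \in G -> restr_perm B g \in restr_perm B @* G.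
Proof. by move=> gG; apply: mem_morphim => //; apply: (subsetP GB). Qed.

Lemma mem_morphim_restrC g :
  g \in G -> restr_perm (~: B) g \in restr_perm (~: B) @* G.
Proof.
by move=> gG; apply: mem_morphim => //; rewrite /= astabsC; apply: (subsetP GB).
Qed.

Lemma morphim_restr_permC_sub : restr_perm (~: B) @* G \subset Sym (~: B).
Proof. by apply/subsetP => _ /morphimP[g _ _ ->]; rewrite inE restr_perm_on. Qed.

Lemma sub_Sym_dprod : G \subset Sym B \x (restr_perm (~: B) @* G).
Proof.
rewrite (dprod_SymC (B := B)) ?morphim_restr_permC_sub //.
apply/subsetP => g gG; rewrite -(restr_permM_setC (subsetP GB g gG)).
apply: mem_mulg; first by rewrite inE restr_perm_on.
exact: mem_morphim_restrC.
Qed.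

Lemma Sym_dprod_sub :
  Sym B \subset G -> Sym B \x (restr_perm (~: B) @* G) \subset G.
Proof.
move=> SG.
rewrite (dprod_SymC (B := B)) ?morphim_restr_permC_sub //.
apply/subsetP => _ /mulsgP[b _ bS /morphimP[g _ gG ->] ->].
apply: groupM; first exact: (subsetP SG).
have gN := subsetP GB g gG.
rewrite /= -[restr_perm _ g](mulKg (restr_perm B g)) restr_permM_setC //.
by rewrite groupM ?groupV // (subsetP SG) // inE restr_perm_on.
Qed.

(** The intersection of [G] with [Sym B] is normal in the projection [Sym B]. Were it trivial,
    restriction to the complement [D] would be injective on [G], giving [#|B|! <= #|D|!]. *)
Lemma Alt_on_sub_subdirect :
  restr_perm B @* G = Sym B ->
  4 < #|B| -> #|~: B| < #|B| -> Alt_on B \subset G.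
Proof.
move=> GS B5 BD; pose N := [group of G :&: Sym B].
suff : Alt_on B \subset N by move/subset_trans; apply; apply: subsetIl.
have restr_in g : g \in G -> restr_perm (~: B) g = 1 -> g \in N.
  move=> gG g1; rewrite inE gG /= -(restr_permM_setC (subsetP GB g gG)) g1 mulg1.
  by rewrite inE restr_perm_on.
apply: Alt_on_sub_normal => //; first exact: subsetIr.
  rewrite -GS; apply/subsetP => _ /morphimP[g _ gG ->]; rewrite inE.
  apply/subsetP => _ /imsetP[u /setIP[uG uB] ->].
  have gN := subsetP GB g gG.
  have us_B : u ^ restr_perm B g \in Sym B by rewrite groupJ // inE restr_perm_on.
  rewrite inE us_B andbT.
  suff -> : u ^ restr_perm B g = u ^ g by rewrite groupJ.
  rewrite -[in RHS](restr_permM_setC gN) conjgM; apply/esym/conjg_fixP/commgP.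
  apply: (@perm_onC _ B (~: B)); rewrite ?restr_perm_on ?disjoints_subset ?setCK //.
  by rewrite inE in us_B.
apply/eqP => N1; have : #|B|`! <= #|~: B|`!.
  rewrite -!card_Sym -GS (leq_trans (leq_morphim _ _)) //.
  apply: (@leq_trans #|restr_perm (~: B) @* G|); last first.
    exact: subset_leq_card morphim_restr_permC_sub.
  rewrite morphimEsub; last by rewrite /= astabsC.
  rewrite card_in_imset // => g h gG hG /= e.
  have gN := subsetP GB g gG; have hN := subsetP GB h hG.
  apply/eqP; rewrite eq_mulgV1 -in_set1 -[[set 1]]N1.
  rewrite restr_in ?groupM ?groupV //.
  have [gD hD] : g \in 'N(~: B | 'P) /\ h \in 'N(~: B | 'P) by rewrite !astabsC.
  by rewrite morphM ?morphV ?groupV //= e mulgV.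
(* The maximum with 1 is there because [0! = 1!]: the factorial increases strictly only from 1
   on. *)
rewrite leqNgt => /negP; apply; apply: leq_ltn_trans (leq_fact (leq_maxr 1 _)) _.
by apply: ltn_fact; lia.
Qed.

End Subdirect.

(** * The two implications and the numerical bound *)

Local Open Scope group_scope.

(** A closed [G] would contain [Sym B]. This makes a subdirect product the full product, and
    contradicts evenness on [B] in the other case. *)
Lemma not_galois_closed_sufficient (n k : nat) (G L : {group 'S_n})
    (B : {set 'I_n}) :
  1 < k -> k < n -> 4 * (n - k) <= n + 2 -> #|~: B| < n - k ->
  L \subset Sym (~: B) ->
  (G : {set 'S_n}) = Alt_on B \x L \/ proper_subdirect B (~: B) (Sym B) L G ->
  ~ galois_closed k G.
Proof.
move=> k1 kn n_large DB LD GE.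
have cardB := cardsC B; rewrite card_ord in cardB.
have kB : k < #|B| by lia.
have DltB : #|~: B| < #|B| by lia.
have AS : Alt_on B \subset Sym B by apply/subsetP => u /[!inE] /andP[].
case: GE => [GE | [[GSL GB GD] GN]] Gcl; last first.
  have GN' : G \subset 'N(B | 'P).
    apply: subset_trans GSL _.
    rewrite (dprod_SymC (B := B)) // mul_subG ?Sym_norm //.
    exact: subset_trans LD (Sym_setC_norm B).
  case: GN; apply/eqP; rewrite eqEsubset GSL -GD Sym_dprod_sub //.
  rewrite -Gcl Sym_sub_galois_closure //.
  (* A nonempty complement forces [d >= 2], hence [#|B| >= 5]. If it is empty, [B] may be small, but
     then [G] equals its projection. *)
  have [D0|D0] := posnP #|~: B|; last by apply: Alt_on_sub_subdirect => //; lia.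
  apply: subset_trans AS _; rewrite -GB; apply/subsetP => _ /morphimP[g _ gG ->].
  have := restr_permM_setC (subsetP GN' g gG).
  by rewrite (perm_on_id (restr_perm_on (~: B) g)) ?D0 // mulg1 => /= ->.
have SG : Sym B \subset G.
  rewrite -Gcl Sym_sub_galois_closure //.
  by rewrite GE (dprod_SymC (B := B)) // mulG_subl.
have /card_gt1P[a [b [aB bB ab]]] : 1 < #|B| by lia.
have : tperm a b \in G by rewrite (subsetP SG) // inE perm_on_tperm.
rewrite GE (dprod_SymC (B := B)) //.
case/mulsgP => u v uA vL e.
have uB : perm_on B u by have := subsetP AS u uA; rewrite inE.
have vD : perm_on (~: B) v by have := subsetP LD v vL; rewrite inE.
move: uA; rewrite inE => /andP[_]; suff -> : u = tperm a b by rewrite odd_tperm ab.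
rewrite -(restr_perm_id uB) -(restr_perm_id (perm_on_tperm aB bB)) e.
rewrite morphM /=.
- by rewrite (restr_perm_eq1 vD) mulg1.
- by apply: (subsetP (Sym_norm B)); rewrite inE.
by apply: (subsetP (Sym_setC_norm B)); rewrite inE.
Qed.

(** The alternative depends on whether some element of [G] restricts to an odd permutation of [B].
    If so, [G] projects onto [Sym B]; it is not the full product, since [Sym B] meets the coset of
    [s]. *)
Lemma not_galois_closed_necessary (n k : nat) (G : {group 'S_n}) :
  1 < k -> 4 * (n - k) <= n + 2 -> ~ galois_closed k G ->
  exists B : {set 'I_n}, #|~: B| < n - k /\
    exists L : {group 'S_n}, L \subset Sym (~: B) /\
    ((G : {set 'S_n}) = Alt_on B \x L \/ proper_subdirect B (~: B) (Sym B) L G).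
Proof.
move=> k1 n_large /eqP; rewrite eqEsubset sub_galois_closure // andbT.
case/subsetPn => s sG sNG.
have [B [DB AG GB]] := ex_larger_Alt_on k1 sG sNG n_large.
exists B; split=> //; exists [group of restr_perm (~: B) @* G].
have LD := morphim_restr_permC_sub B G; split=> //.
have cardB := cardsC B; rewrite card_ord in cardB.
have [odd_g|/forall_inPn] := boolP [forall g in G, ~~ odd_perm (restr_perm B g)].
  left; rewrite (dprod_SymC (B := B)) //; last first.
    by apply/subsetP => u /[!inE] /andP[].
  have restrG g : g \in G -> restr_perm B g \in Alt_on B.
    by move=> gG; rewrite !inE restr_perm_on (forall_inP odd_g).
  apply/eqP; rewrite eqEsubset; apply/andP; split.
    apply/subsetP => g gG; rewrite -(restr_permM_setC (subsetP GB g gG)).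
    by rewrite mem_mulg ?restrG ?mem_morphim_restrC.
  rewrite mul_subG //=; apply/subsetP => _ /morphimP[g _ gG ->].
  rewrite /= -[restr_perm _ g](mulKg (restr_perm B g)).
  rewrite restr_permM_setC ?(subsetP GB) //.
  by rewrite groupM ?groupV // (subsetP AG) ?restrG.
case=> g gG; rewrite negbK => g_odd; right; split; last first.
  move=> GE; case/negP: sNG.
  have SG : Sym B \subset G.
    by rewrite GE (dprod_SymC (B := B)) //
      mulG_subl.
  have [|c cG cS] := galois_closure_Sym k1 (B := B) _ sG; first by lia.
  by rewrite mem_rcoset groupMl ?groupV in cG; last exact: (subsetP SG).
split; first exact: sub_Sym_dprod; last by [].
apply/eqP; rewrite eqEsubset; apply/andP; split.
  by apply/subsetP => _ /morphimP[h _ _ ->]; rewrite inE restr_perm_on.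
have imG u : u \in G -> u \in Sym B -> u \in restr_perm B @* G.
  move=> uG; rewrite inE => uB; rewrite -(restr_perm_id uB).
  exact: mem_morphim_restr.
have AimG u : u \in Alt_on B -> u \in restr_perm B @* G.
  move=> uA; apply: imG; first exact: (subsetP AG).
  by move: uA; rewrite !inE => /andP[].
have gim := mem_morphim_restr GB gG.
apply/subsetP => u uS; have [u_odd|u_even] := boolP (odd_perm u); last first.
  by apply: AimG; rewrite inE uS.
rewrite -(groupMr _ gim) AimG // !inE odd_permM u_odd g_odd andbT.
by apply: perm_onM; [move: uS; rewrite inE | apply: restr_perm_on].
Qed.

(** From [n >= d^2 + d + 1] and [d^2 - 3d + 3 > 0]. *)
Lemma degree_bound (n k : nat) : k < n ->
  let d : int := (n%:Z - k%:Z)%R in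
  (Num.max ((2 : rat) ^ d) (d ^+ 2 + d)%:~R < n%:R)%R ->
  4 * (n - k) <= n + 2.
Proof.
move=> kn d; rewrite Order.TotalTheory.gt_max => /andP[_].
rewrite -[n%:R%R]/((n%:Z)%:~R)%R ltr_int /d subzn ?(ltnW kn) // GRing.expr2.
rewrite -PoszM -PoszD ltz_nat; move: (n - k) => m.
case: m => [|[|[|m]]]; lia.
Qed.

Theorem theorem3p1 (n k : nat) (G : {group 'S_n}) :
  (2 <= n)%N -> (2 <= k)%N ->
  let d : int := (n%:Z - k%:Z)%R in
  (Num.max ((2 : rat) ^ d) (d ^+ 2 + d)%:~R < n%:R)%R ->
  (~ galois_closed k G) <->
  (exists B : {set 'I_n}, let D := (~: B)%SET in
     (#|D|%:Z < d)%R /\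
     exists L : {group 'S_n}, L \subset perm.Sym D /\
       ((G : {set 'S_n}) = (Alt_on B \x L)%g \/
        proper_subdirect B D (perm.Sym B) L G)).
Proof.
move=> n2 k2 d dn; split=> [Gncl | [B [DB [L [LD GE]]]]]; last first.
  have kn : k < n by rewrite /d in DB; lia.
  apply: (not_galois_closed_sufficient k2 kn (degree_bound kn dn) _ LD GE).
  by rewrite /d in DB; lia.
have n_large : 4 * (n - k) <= n + 2.
  (* For [n <= k] the truncated difference is 0, although the integer [d] may be negative. *)
  have [kn|kn] := posnP (n - k); first by rewrite kn; lia.
  by apply: degree_bound dn; rewrite -subn_gt0.
have [B [DB [L [LD GE]]]] := not_galois_closed_necessary k2 n_large Gncl.
exists B; split; first by rewrite /d; lia.
by exists L.
Qed.
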